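(* Let $X$ be a second countable (equivalently, countable) discrete Abelian group and let $n \geq 2$ be an integer. Let $\xi_1,\ldots,\xi_n$ be independent random variables with values in $X$ and with distributions $\mu_1,\ldots,\mu_n$ respectively. Let $\alpha_{ij}\in \mathrm{Aut}(X)$ for $i,j=1,2,\ldots,n$, and consider the linear forms $L_j=\sum_{i=1}^{n}\alpha_{ij}\xi_i$, $j=1,2,\ldots,n$. If the random variables $L_1,\ldots,L_n$ are independent, then for each $i=1,2,\ldots,n$ there exist a finite subgroup $G_i$ of $X$ and an element $x_i\in X$ such that $\mu_i=E_{x_i}\ast m_{G_i}$.
   Context: $\mathrm{Aut}(X)$ is the group of topological automorphisms of $X$ (for discrete $X$, all group automorphisms). A distribution on $X$ is a Borel probability measure on $X$. For $x\in X$, $E_x$ denotes the degenerate distribution concentrated at the point $x$. For a compact subgroup $K$ of $X$, $m_K$ denotes the Haar distribution on $K$ (the normalized Haar measure of $K$, regarded as a distribution on $X$); for finite $K$ it is the uniform distribution on $K$. The symbol $\ast$ denotes convolution of distributions. Independence of a finite family of random variables means mutual independence. *)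

(* Defs.v *)
From HB Require Import structures.
From mathcomp Require Import all_boot all_order all_algebra.
From mathcomp Require Import finmap.
From mathcomp Require Import all_classical all_reals all_analysis.

Set Implicit Arguments.
Unset Strict Implicit.
Unset Printing Implicit Defensive.

Import Order.TTheory GRing.Theory Num.Theory.

Local Open Scope classical_set_scope.
Local Open Scope ring_scope.

(* The library only builds g_sigma_algebraType over a pointedType, and a
   topologicalZmodType is not pointed; hence this alias, pointed by 0. *)
Definition borel (X : topologicalZmodType) : Type := X.

Section borel_instances.
Variable X : topologicalZmodType.

Let borelC (A : set X) : <<s @open X >> A -> <<s @open X >> (~` A).
Proof. by move=> sA; rewrite -setTD; exact: sigma_algebraCD. Qed.

HB.instance Definition _ := Choice.copy (borel X) X.
HB.instance Definition _ := isPointed.Build (borel X) (0 : X).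
HB.instance Definition _ := @isMeasurable.Build (sigma_display (@open X))
  (borel X) <<s @open X >> (@sigma_algebra0 _ setT (@open X)) borelC
  (@sigma_algebra_bigcup _ setT (@open X)).

End borel_instances.

Definition discrete_topological (X : topologicalType) : Prop :=
  forall A : set X, open A.

Definition topological_automorphism (X : topologicalZmodType) (f : X -> X) :
    Prop :=
  [/\ {morph f : x y / x + y}, continuous f &
      exists2 g : X -> X, cancel f g /\ cancel g f & continuous g].

Definition mutually_independent {d d' : measure_display}
    {Omega : measurableType d} {T : measurableType d'} {R : realType}
    (P : probability Omega R) (I : finType) (Y : I -> Omega -> T) : Prop :=
  forall (J : {set I}) (B : I -> set T),
    (forall i, i \in J -> measurable (B i)) ->
    P (\bigcap_(i in [set` J]) Y i @^-1` B i) =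
    (\prod_(i in J) P (Y i @^-1` B i))%E.

Definition convolution {X : topologicalZmodType} {R : realType}
    (mu nu : probability (borel X) R) : set (borel X) -> \bar R :=
  pushforward (mu \x nu)%E
    (fun p : borel X * borel X => ((p.1 : X) + (p.2 : X) : X) : borel X).

Record finite_subgroup (X : zmodType) := FiniteSubgroup {
  elements :> {fset X};
  elements_closed : zmod_closed (mem elements) }.

Section haar.
Context {X : topologicalZmodType} (R : realType).
Variable G : finite_subgroup X.

(* On a finite subgroup the normalized Haar measure is the uniform
   distribution, written A |-> #|A `&` G| / #|G|. *)
Definition haar (A : set (borel X)) : \bar R :=
  (#|` [fset g in elements G | g \in (A : set X)]%fset|%:R /
   #|` elements G|%:R)%:E.

Let nth_pt (k : nat) : borel X := nth 0 (elements G) k.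

Let haarE : haar = mscale (#|` elements G|%:R^-1)%:nng
  (msum (fun k => \d_(nth_pt k)) #|` elements G|).
Proof.
apply/funext => A; rewrite /haar /mscale /= /msum mulrC EFinM; congr (_ * _)%E.
under eq_bigr do rewrite /= diracE.
rewrite sumEFin; congr EFin; rewrite -natr_sum; congr _%:R.
rewrite (_ : #|` _| = count (fun g : X => g \in (A : set X)) (elements G))%N; last first.
  rewrite -size_filter; apply: perm_size; apply: uniq_perm => //.
    by rewrite filter_uniq.
  by move=> g; rewrite mem_filter !inE andbC.
by rewrite -sum1_count big_mkcond /= (big_nth 0) big_mkord.
Qed.

Let haar0 : haar set0 = 0%E. Proof. by rewrite haarE measure0. Qed.

Let haar_ge0 A : (0 <= haar A)%E. Proof. by rewrite haarE. Qed.

Let haar_sigma_additive : semi_sigma_additive haar.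
Proof. by rewrite haarE; exact: measure_semi_sigma_additive. Qed.

HB.instance Definition _ := isMeasure.Build _ _ _ haar
  haar0 haar_ge0 haar_sigma_additive.

Let haar_setT : haar setT = 1%E.
Proof.
rewrite /haar (_ : [fset g in _ | _] = elements G)%fset; last first.
  by apply/fsetP => g; rewrite !inE /= in_setT andbT.
rewrite divff // pnatr_eq0 -lt0n cardfs_gt0.
by apply/fset0Pn; exists 0; case: (elements_closed G).
Qed.

HB.instance Definition _ := Measure_isProbability.Build _ _ _ haar haar_setT.

Lemma haar_support : haar [set g | g \in elements G] = 1%E.
Proof.
rewrite -haar_setT /haar; congr (_%:R / _)%:E; congr #|` _|.
apply/fsetP => g; rewrite !inE /= in_setT andbT.
by apply: andb_idr => gG; exact/mem_set.
Qed.

Lemma haar_invariant (g : X) (A : set (borel X)) : g \in elements G ->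
  haar [set x | A ((g : X) + x)] = haar A.
Proof.
move=> gG; have [G0 GB] := elements_closed G.
have GN x : x \in elements G -> - x \in elements G.
  by move=> xG; rewrite -sub0r; exact: GB.
have GD x y : x \in elements G -> y \in elements G -> x + y \in elements G.
  by move=> xG yG; rewrite -[y]opprK; apply: GB => //; exact: GN.
have cardE (S : {fset X}) : #|` [fset (g + x)%R | x in S]%fset| = #|` S|.
  by rewrite card_imfset //; exact: addrI.
rewrite /haar; congr (_%:R / _)%:E.
rewrite -[LHS]cardE; congr #|` _|.
apply/fsetP => y; apply/imfsetP/idP => /= [[x]|].
  by rewrite !inE /= => /andP[xG] /set_mem Ax ->; rewrite GD//; exact/mem_set.
rewrite !inE /= => /andP[yG yA]; exists (y - g); last by rewrite addrC subrK.
by rewrite !inE /= GB//=; apply/mem_set; rewrite /= addrC subrK; exact/set_mem.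
Qed.

End haar.
Arguments haar {X R} G.

(* Main.v *)
Require Import Defs.
From HB Require Import structures.
From mathcomp Require Import all_boot all_order all_algebra.
From mathcomp Require Import perm.
From mathcomp Require Import finmap.
From mathcomp Require Import all_classical all_reals all_analysis.
From mathcomp Require Import lra.

Set Implicit Arguments.
Unset Strict Implicit.
Unset Printing Implicit Defensive.

Import Order.TTheory GRing.Theory Num.Theory.

Local Open Scope classical_set_scope.
Local Open Scope ring_scope.

(** Why the theorem holds. On a countable group the concentration of a
    distribution can be measured by its largest atom, and adding an independent
    variable can only lower it. Let [m i] be the largest atom of [mu i], reached
    at a mode [p i], and let [b j] be the value of the form [L j] at the point
    [(p i)_i].

    On one side, the event that every [xi i] equals [p i] is contained in the
    event that every [L j] equals [b j]; by the two independence hypotheses,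
    [\prod_i m i <= \prod_j P (L j = b j)]. On the other side, once all
    variables but [xi i] are given, the equation [L j = b j] prescribes [xi i],
    because [alpha i j] is injective; hence [P (L j = b j) <= m i] for all [i]
    and [j] ([determined_event_le]). There are as many forms as variables, so
    the two bounds can only be compatible if [P (L j = b j) = m i] for all [i]
    and [j] ([all_ge_of_prod_ge], [form_atom_ge]).

    The average over the other variables that gives [P (L j = b j) <= m i] is
    thus an equality, and so each of its terms of positive weight is: whenever
    the other variables take possible values, the value of [xi i] prescribed by
    [L j = b j] is again a mode of [xi i] ([determined_value_mode]). Changing
    only the value of [xi k] from its mode [p k] to an arbitrary point [s] of its
    support shows that, for every mode [x] of [xi i], the point
    [x + alpha_ij^-1 (alpha_kj (p k - s))] is a mode of [xi i].

    The rest is counting. Modes are finitely many, since each has mass [m i], so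
    for [k != i] the support of [xi k] has at most as many points as [xi i] has
    modes; exchanging the roles of [i] and [k], supports and sets of modes all
    have the same size. Then every support consists of modes, so [mu i] is
    uniform on its support, and the translation property above forces the
    support to be a coset of a finite subgroup
    ([coset_of_mutual_translates]). *)

(** * Finite sets stable under many translations are cosets *)

Section coset.
Variable X : zmodType.

(** Each translate [x + gam S'], with [x] in [M], lies in [M] but has at least as
    many points as [S], hence equals [S]. So any [x] in [S] is [y + gam s] for any
    prescribed [y] in [S]: the differences [x - y] are values of [gam], and
    adding those to [a] leads back into [S]. *)
Lemma coset_of_translates (S M S' : {fset X}) (gam : X -> X) (a : X) :
    injective gam -> (M `<=` S)%fset -> (#|` S| <= #|` S'|)%N -> a \in M ->
    (forall x s, x \in M -> s \in S' -> x + gam s \in M) ->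
  M = S /\ zmod_closed (mem [fset (x - a)%R | x in S]%fset).
Proof.
move=> gam_inj MS cardS aM step.
have fill x : x \in M -> [fset (x + gam s)%R | s in S']%fset = S.
  move=> xM; apply/eqP; rewrite eqEfcard; apply/andP; split.
    by apply/fsubsetP => _ /imfsetP[s /= sS' ->]; exact/(fsubsetP MS)/step.
  by rewrite card_imfset//= => s t /addrI /gam_inj.
have SM : M = S.
  apply/eqP; rewrite eqEfsubset MS /= -(fill a aM).
  by apply/fsubsetP => _ /imfsetP[s /= sS' ->]; exact: step.
split=> //; split=> [|_ _ /imfsetP[x /= xS ->] /imfsetP[y /= yS ->]].
  by apply/imfsetP; exists a; rewrite ?subrr// -SM.
have : x \in [fset (y + gam s)%R | s in S']%fset by rewrite fill// SM.
move=> /imfsetP[s /= sS' ->]; apply/imfsetP; exists (a + gam s) => /=.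
  by rewrite -SM; exact: step.
by rewrite opprB addrA subrK [y + _]addrC addrK addrAC subrr add0r.
Qed.

(** In the application [S] and [S'] are the supports of two of the variables, and
    [M] and [M'] their sets of modes. The two translation properties embed [S']
    in [M] and [S] in [M'], which provides both the finiteness of the supports
    and the comparison of sizes needed above. *)
Lemma coset_of_mutual_translates (S M S' M' : set X) (gam gam' : X -> X)
    (a a' : X) :
    injective gam -> injective gam' -> M `<=` S -> M' `<=` S' ->
    finite_set M -> finite_set M' -> M a -> M' a' ->
    (forall x s, M x -> S' s -> M (x + gam s)) ->
    (forall x s, M' x -> S s -> M' (x + gam' s)) ->
  M = S /\ exists G : finite_subgroup X, S = [set x | x - a \in elements G].
Proof.
move=> gam_inj gam'_inj MS MS' Mfin M'fin Ma M'a' step step'.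
have S'fin : finite_set S'.
  apply: (@sub_finite_set _ _ ((fun s => a + gam s) @^-1` M)).
    by move=> s S's; exact: step.
  by apply: finite_preimage => // s t _ _ /addrI /gam_inj.
have Sfin : finite_set S.
  apply: (@sub_finite_set _ _ ((fun s => a' + gam' s) @^-1` M')).
    by move=> s Ss; exact: step'.
  by apply: finite_preimage => // s t _ _ /addrI /gam'_inj.
have fsetE A : finite_set A -> forall x : X, (x \in fset_set A) = (x \in A).
  by move=> Afin x; rewrite in_fset_set.
have cardS : (#|` fset_set S| <= #|` fset_set S'|)%N.
  have <- : #|` [fset (a' + gam' s)%R | s in fset_set S]%fset| = #|` fset_set S|.
    by rewrite card_imfset//= => s t /addrI /gam'_inj.
  apply: fsubset_leq_card; apply/fsubsetP => _ /imfsetP[s /= + ->].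
  by rewrite !fsetE// !inE => Ss; apply: MS'; exact: step'.
have MSf : (fset_set M `<=` fset_set S)%fset.
  by apply/fsubsetP => x; rewrite !fsetE// !inE; exact: MS.
have aM : a \in fset_set M by rewrite fsetE// inE.
have stepf x s : x \in fset_set M -> s \in fset_set S' ->
    x + gam s \in fset_set M.
  by rewrite !fsetE// !inE; exact: step.
have [MSE closed] := coset_of_translates gam_inj MSf cardS aM stepf.
split; first by rewrite -(fset_setK Mfin) MSE fset_setK.
exists (FiniteSubgroup closed); apply/seteqP; split=> x /=.
  by move=> Sx; apply/imfsetP; exists x => //=; rewrite fsetE// inE.
by move=> /imfsetP[y /= + /addIr ->]; rewrite fsetE// inE.
Qed.

End coset.

(** * Atoms of a probability on a countable space *)

Section fibers.
Context d (Omega : measurableType d) (R : realType) (P : probability Omega R).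

(** Law of total probability for the partition into fibers of [V], over a set [D]
    of indices: keeping [D] arbitrary is what allows the equality case to
    single out one fiber. *)
Lemma le_probability_fibers (V : Omega -> nat) (A : set Omega) (c : R)
    (D : set nat) :
    (forall k, measurable (V @^-1` [set k])) -> measurable A ->
    (forall w, (P (A `&` V @^-1` [set V w]) <= c%:E * P (V @^-1` [set V w]))%E) ->
  (P (A `&` V @^-1` D) <= c%:E * P (V @^-1` D))%E.
Proof.
move=> mV mA h.
have tV : trivIset D (fun k => V @^-1` [set k]).
  by move=> k l _ _ [w [/= <- <-]].
have -> : V @^-1` D = \bigcup_(k in D) V @^-1` [set k].
  apply/seteqP; split=> [w Dw|w [k Dk /= wk]]; first by exists (V w).
  by rewrite /preimage /= wk.
rewrite setI_bigcupr !measure_bigcup//; first last.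
- by move=> k l Dk Dl [w [[_ wk] [_ wl]]]; apply: tV => //; exists w.
- by move=> k _; exact: measurableI.
rewrite -nneseriesZl//; apply: lee_nneseries => // k Dk.
have [->|/set0P[w /= <-]] := eqVneq (V @^-1` [set k]) set0.
  by rewrite setI0 measure0 mule0.
exact: h.
Qed.

End fibers.

Section modes.
Context d (T : measurableType d) (R : realType) (Q : probability T R).
Hypotheses (T_countable : countable [set: T])
  (set1_measurable : forall t : T, measurable [set t]).

Let set_measurable (A : set T) : measurable A.
Proof.
apply: countable_measurable => //.
by apply: sub_countable T_countable; exact: subset_card_le.
Qed.

Lemma null_of_null_atoms (A : set T) :
  (forall t, A t -> Q [set t] = 0%E) -> Q A = 0%E.
Proof.
move=> A0.
have /countable_injP[f injf] := T_countable.
have fE t : f @^-1` [set f t] = [set t].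
  apply/seteqP; split=> [s /= fst|_ /= ->//].
  by apply: injf => //; rewrite inE.
apply/eqP; rewrite eq_le measure_ge0 andbT.
have := @le_probability_fibers _ _ _ Q f A 0 setT.
rewrite preimage_setT setIT mul0e; apply=> // t.
rewrite fE mul0e; have [At|nAt] := pselect (A t).
  by rewrite -(A0 _ At) le_measure ?inE//; exact: measurableI.
by rewrite (_ : A `&` _ = set0) ?measure0// -subset0 => s [As /= st]; subst.
Qed.

Lemma probability_fset (S : {fset T}) :
  Q [set` S] = (\sum_(t <- S) Q [set t])%E.
Proof.
rewrite -measure_fbigsetU//; last by move=> s t _ _ [x [-> ->]].
rewrite -bigcup_fset; congr (Q _).
by apply/seteqP; split=> [s Ss|s [t St ->]//]; exists s.
Qed.

Lemma card_large_atoms (S : {fset T}) (c : R) :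
  (forall t, t \in S -> (c%:E <= Q [set t])%E) -> #|` S|%:R * c <= 1.
Proof.
move=> cS; rewrite -lee_fin.
apply: le_trans (probability_le1 Q (_ : measurable [set` S])); last first.
  exact: set_measurable.
rewrite probability_fset big_seq mulr_natl.
rewrite (_ : _%:E = (\sum_(t <- S | t \in S) c%:E)%E).
  by apply: lee_sum => t; exact: cS.
by rewrite -big_seq sumEFin big_const_seq count_predT iter_addr_0.
Qed.

Lemma finite_large_atoms (c : R) : 0 < c ->
  finite_set [set t | (c%:E <= Q [set t])%E].
Proof.
move=> c0; apply: contrapT => /(@infinite_set_fset T).
move=> /(_ (Num.bound c^-1)) [S SB cardS].
have := card_large_atoms (fun t St => SB t St).
have : c^-1 < #|` S|%:R.
  apply: lt_le_trans (_ : (Num.bound c^-1)%:R <= _); last by rewrite ler_nat.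
  by apply: archi_boundP; rewrite invr_ge0 ltW.
by rewrite -(ltr_pM2r c0) mulVf ?gt_eqF// => /lt_le_trans h /h; rewrite ltxx.
Qed.

(** Some atom is positive, as the space is countable, and only finitely many are
    at least as large as that one. *)
Lemma exists_mode : exists a, (0 < Q [set a])%E /\
  forall t, (Q [set t] <= Q [set a])%E.
Proof.
have [t0 t0_gt0] : exists t0, (0 < Q [set t0])%E.
  apply: contrapT => /forallNP n0.
  have : Q setT = 0%E.
    apply: null_of_null_atoms => t _; apply/eqP.
    by rewrite eq_le measure_ge0 andbT leNgt; apply/negP/n0.
  by rewrite probability_setT => /eqP; rewrite onee_eq0.
have Qfin t : Q [set t] = (fine (Q [set t]))%:E.
  by rewrite fineK// fin_num_measure.
have /finite_fsetP[F FE] : finite_set [set t | (Q [set t0] <= Q [set t])%E].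
  by rewrite Qfin; apply: finite_large_atoms; rewrite -lte_fin -Qfin.
have Ft t : (t \in F) = (Q [set t0] <= Q [set t])%E.
  have /seteqP[QF FQ] := FE.
  by apply/idP/idP => [/FQ|/QF].
have t0F : t0 \in F by rewrite Ft.
pose h (u : F) := Q [set val u].
have [a _ amax] := @Order.TotalTheory.arg_maxP _ _ _ [` t0F]%fset xpredT h isT.
exists (val a); split.
  exact: lt_le_trans t0_gt0 (amax [` t0F]%fset isT).
move=> t; have [tF|] := boolP (t \in F); first exact: (amax [` tF]%fset isT).
rewrite Ft -ltNge => /ltW /le_trans; apply; exact: (amax [` t0F]%fset isT).
Qed.

End modes.

(** * Events that determine one variable of an independent family *)

Lemma countable_ffun (I : finType) (T : Type) :
  countable [set: T] -> countable [set: {ffun I -> T}].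
Proof.
move=> /countable_injP[f injf]; apply/countable_injP.
exists (fun t => choice.pickle [ffun k => f (t k)]).
move=> s t _ _ /(pcan_inj choice.pickleK)/ffunP E; apply/ffunP => k.
by apply: injf; rewrite ?inE//; have := E k; rewrite !ffunE.
Qed.

Section cylinders.
Context d d' (Omega : measurableType d) (T : measurableType d') (R : realType).
Variables (P : probability Omega R) (I : finType) (Y : I -> Omega -> T).
Hypotheses (T_countable : countable [set: T])
  (set1_measurable : forall t : T, measurable [set t])
  (Y_measurable : forall i, measurable_fun [set: Omega] (Y i))
  (Y_indep : mutually_independent P Y).

Definition cylinder (J : {set I}) (t : I -> T) : set Omega :=
  \bigcap_(k in [set` J]) Y k @^-1` [set t k].

Let measurable_fiber i u : measurable (Y i @^-1` [set u]).
Proof. by rewrite -[X in measurable X]setTI; exact: Y_measurable. Qed.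

Lemma measurable_cylinder J t : measurable (cylinder J t).
Proof. by apply: fin_bigcap_measurable => // k _; exact: measurable_fiber. Qed.

Lemma probability_cylinder J t :
  P (cylinder J t) = (\prod_(k in J) P (Y k @^-1` [set t k]))%E.
Proof. exact: Y_indep. Qed.

Lemma cylinder_gt0 (J : {set I}) t :
    (forall k, k \in J -> (0 < P (Y k @^-1` [set t k]))%E) ->
  (0 < P (cylinder J t))%E.
Proof.
move=> Yt; rewrite probability_cylinder.
by elim/big_ind: _ => [|x y|k]; [rewrite lte01|exact: mule_gt0|exact: Yt].
Qed.

(** A function of finitely many variables with countably many values is
    measurable, whatever the function: its level events are countable unions of
    cylinders. *)
Lemma measurable_joint (D : set {ffun I -> T}) :
  measurable [set w | D [ffun k => Y k w]].
Proof.
rewrite (_ : [set w | _] =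
  \bigcup_t if t \in D then cylinder [set: I] t else set0); last first.
  apply/seteqP; split=> [w Dw|w [t _]] /=.
    by exists [ffun k => Y k w] => //; rewrite mem_set// => k _; rewrite /= ffunE.
  case: ifPn => // /set_mem Dt wt; rewrite (_ : [ffun k => _] = t)//.
  by apply/ffunP => k; rewrite ffunE; apply: wt; rewrite /= inE.
apply: countable_bigcupT_measurable => [|t]; first exact: countable_ffun.
by case: ifPn => // _; exact: measurable_cylinder.
Qed.

(** Independence of one variable from all the others: the intersection is a full
    cylinder, whose mass is a product. *)
Lemma probability_cylinderI i t u :
  P (Y i @^-1` [set u] `&` cylinder [set~ i] t) =
  (P (Y i @^-1` [set u]) * P (cylinder [set~ i] t))%E.
Proof.
pose t' k := if k == i then u else t k.
have -> : Y i @^-1` [set u] `&` cylinder [set~ i] t = cylinder [set: I] t'.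
  apply/seteqP; split=> [w [/= wi wt] k _|w wt]; rewrite /=.
    rewrite /t'; have [->//|ki] := eqVneq k i.
    by apply: wt; rewrite /= !inE.
  split=> [|k]; rewrite /= ?inE.
    by have := wt i; rewrite /= /t' eqxx inE; exact.
  by have := wt k; rewrite /= /t' inE => /(_ isT); case: eqVneq.
rewrite !probability_cylinder (bigD1 i)/= ?inE// /t' eqxx; congr (_ * _)%E.
by apply: eq_big => k; rewrite !inE //= => /negPf ->.
Qed.

Section conditioning.
Variables (i : I) (A : set Omega) (m : R).
Hypotheses (A_measurable : measurable A)
  (atom_le : forall u, (P (Y i @^-1` [set u]) <= m%:E)%E)
  (A_determines : forall t, exists u,
     A `&` cylinder [set~ i] t `<=` Y i @^-1` [set u]).

Let determined_le t u : A `&` cylinder [set~ i] t `<=` Y i @^-1` [set u] ->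
  (P (A `&` cylinder [set~ i] t) <=
   P (Y i @^-1` [set u]) * P (cylinder [set~ i] t))%E.
Proof.
move=> Au; rewrite -probability_cylinderI le_measure ?inE//.
- by apply: measurableI => //; exact: measurable_cylinder.
- by apply: measurableI => //; exact: measurable_cylinder.
- by move=> w [Aw tw]; split=> //; exact: Au.
Qed.

(** Conditioning on the variables other than [Y i] is encoded by an index with
    values in [nat]: the coordinate [i] is overwritten by a constant, so that the
    fibers are exactly the cylinders that leave [Y i] free. *)
Let conditioning_index : exists V : Omega -> nat,
  forall w, V @^-1` [set V w] = cylinder [set~ i] (Y^~ w).
Proof.
have /countable_injP[f injf] := countable_ffun I T_countable.
exists (fun w => f [ffun k => if k == i then point else Y k w]) => w.
apply/seteqP; split=> [v /= /injf|v vw]; last first.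
  congr f; apply/ffunP => k; rewrite !ffunE.
  by case: eqVneq => // ki; apply: vw; rewrite /= !inE.
rewrite !inE => /(_ Logic.I Logic.I)/ffunP E k.
by rewrite /= !inE => /negPf ki; have := E k; rewrite !ffunE ki.
Qed.

Let m_ge0 : 0 <= m.
Proof.
have [u _] := A_determines (fun=> point).
by rewrite -lee_fin; exact: le_trans (measure_ge0 _ _) (atom_le u).
Qed.

(** Both bounds are the same sum over the values of the other variables, taken
    once without the term of index [t] and once in full. *)
Let complement_le t : (P (A `\` cylinder [set~ i] t) <=
  m%:E * P (~` cylinder [set~ i] t))%E /\ (P A <= m%:E)%E.
Proof.
have [V VE] := conditioning_index.
have mV k : measurable (V @^-1` [set k]).
  have [->//|/set0P[w /= <-]] := eqVneq (V @^-1` [set k]) set0.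
  by rewrite VE; exact: measurable_cylinder.
have key D : (P (A `&` V @^-1` D) <= m%:E * P (V @^-1` D))%E.
  apply: le_probability_fibers => // w; rewrite VE.
  have [u Au] := A_determines (Y^~ w).
  by apply: le_trans (determined_le Au) _; rewrite lee_wpmul2r.
have Am : (P A <= m%:E)%E.
  have := key setT; rewrite preimage_setT setIT.
  by rewrite probability_setT mule1.
split=> //; have [->|/set0P[w wt]] := eqVneq (cylinder [set~ i] t) set0.
  by rewrite setD0 setC0 probability_setT mule1.
have -> : cylinder [set~ i] t = V @^-1` [set V w].
  rewrite VE; apply/seteqP; split=> v vt k ki /=; first by rewrite vt// wt.
  by rewrite (vt k ki); exact: wt.
by rewrite setDE; exact: key (~` [set V w]).
Qed.

(** Given the other variables, [A] leaves at most one value to [Y i], and that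
    value has probability at most [m]. *)
Lemma determined_event_le : (P A <= m%:E)%E.
Proof. by have [] := complement_le (fun=> point). Qed.

(** The equality case of the previous bound: outside the cylinder [A] has
    conditional probability at most [m], so a deficit inside the cylinder, which
    has positive mass, could not be made up for. *)
Lemma determined_value_mode t u : (0 < P (cylinder [set~ i] t))%E ->
    A `&` cylinder [set~ i] t `<=` Y i @^-1` [set u] ->
    (m%:E <= P A)%E ->
  (m%:E <= P (Y i @^-1` [set u]))%E.
Proof.
set E := cylinder _ _ => E0 Au mA.
have mE : measurable E by exact: measurable_cylinder.
have [nE _] := complement_le t.
have PA : P A = (P (A `\` E) + P (A `&` E))%E by exact: measureDI.
have := determined_le Au; move: nE mA E0; rewrite -/E.
rewrite PA probability_setC//.
have finP B : measurable B -> P B = (fine (P B))%:E.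
  by move=> mB; rewrite fineK// fin_num_measure.
rewrite (finP _ (measurableD A_measurable mE)).
rewrite (finP _ (measurableI _ _ A_measurable mE)).
rewrite (finP _ mE) (finP _ (measurable_fiber i u)).
rewrite -EFinB -!EFinM -EFinD !lee_fin lte_fin => H1 H2 E0 H3.
rewrite -(ler_pM2r E0); lra.
Qed.

End conditioning.
End cylinders.

(** * Equality of the largest atoms *)

(** If [m i <= q j] failed for one pair, matching that [j] with that [i] and the
    remaining indices by the transposition of [i] and [j] would bound the product
    of the [q] strictly below that of the [m]. *)
Lemma all_ge_of_prod_ge (R : realType) (I : finType) (m q : I -> R) :
    (forall i, 0 < m i) -> (forall j, 0 <= q j) ->
    (forall i j, q j <= m i) -> \prod_i m i <= \prod_j q j ->
  forall i j, m i <= q j.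
Proof.
move=> m0 q0 qm mq i j; rewrite leNgt; apply/negP => ltq.
have : \prod_k q k < \prod_k m k.
  rewrite [ltRHS](reindex_inj (@perm_inj _ (tperm i j))) /=.
  rewrite (bigD1 j)//= [ltRHS](bigD1 j)//= tpermR.
  apply: le_lt_trans (_ : q j * \prod_(k | k != j) m (tperm i j k) < _).
    by rewrite ler_wpM2l// ler_prod// => k _; rewrite q0 qm.
  by rewrite ltr_pM2r// prodr_gt0.
by rewrite ltNge mq.
Qed.

(** This is where the number of forms and the number of variables must agree:
    the joint event [forall i, Y i = a i] has mass [\prod_i m i], it is contained
    in [forall j, L j = b j], and each of the factors of the latter is at most
    every [m i]. *)
Lemma form_atom_ge (R : realType) d d' (Omega : measurableType d)
    (T : measurableType d') (P : probability Omega R) (I : finType)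
    (Y L : I -> Omega -> T) (a b : I -> T) (m : I -> R) :
    countable [set: T] -> (forall t : T, measurable [set t]) ->
    (forall i, measurable_fun [set: Omega] (Y i)) ->
    (forall i, measurable_fun [set: Omega] (L i)) ->
    mutually_independent P Y -> mutually_independent P L ->
    (forall i, P (Y i @^-1` [set a i]) = (m i)%:E) -> (forall i, 0 < m i) ->
    (forall i u, (P (Y i @^-1` [set u]) <= (m i)%:E)%E) ->
    (forall w, (forall i, Y i w = a i) -> forall j, L j w = b j) ->
    (forall i j (t : I -> T), exists u,
       L j @^-1` [set b j] `&` cylinder Y [set~ i] t `<=` Y i @^-1` [set u]) ->
  forall i j, ((m i)%:E <= P (L j @^-1` [set b j]))%E.
Proof.
move=> cT mT mY mL indepY indepL Ya m0 Ym Lab det.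
pose q j := fine (P (L j @^-1` [set b j])).
have mLb j : measurable (L j @^-1` [set b j]).
  by rewrite -[X in measurable X]setTI; exact: mL.
have qE j : P (L j @^-1` [set b j]) = (q j)%:E.
  by rewrite /q fineK// fin_num_measure.
move=> i j; rewrite qE lee_fin; apply: all_ge_of_prod_ge i j => //.
- by move=> j; rewrite -lee_fin -qE.
- move=> i j; rewrite -lee_fin -qE.
  exact: (@determined_event_le _ _ _ _ _ _ _ Y).
have : (P (cylinder Y [set: I] a) <= P (cylinder L [set: I] b))%E.
  rewrite le_measure ?inE//; try exact: measurable_cylinder.
  by move=> w wa j _; apply: Lab => i; apply: wa; rewrite /= inE.
rewrite !probability_cylinder//.
have E (S : I -> set Omega) (r : I -> R) : (forall i, P (S i) = (r i)%:E) ->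
    (\prod_(k in [set: I]%SET) P (S k))%E = (\prod_k r k)%:E.
  move=> Sr; rewrite (eq_bigr (fun k => (r k)%:E))//.
  by rewrite prodEFin; congr EFin; apply: eq_bigl => k; rewrite inE.
by rewrite (E _ m)// (E _ q)// lee_fin.
Qed.

(** * Discrete topological groups *)

Section discrete.
Variable X : topologicalZmodType.
Hypothesis X_discrete : discrete_topological X.

Lemma discrete_countable : @second_countable X -> countable [set: X].
Proof.
move=> [B B_countable [_ B_basis]].
have B1 x : B [set x].
  have [|U [BU Ux] Ux1] := B_basis x [set x].
    by apply: open_nbhs_nbhs; split.
  by rewrite (_ : [set x] = U)//; apply/seteqP; split=> // _ ->.
have /countable_injP[f injf] := B_countable.
apply/countable_injP; exists (f \o set1) => x y _ _ /= /injf.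
by rewrite !inE => /(_ (B1 x) (B1 y)) /seteqP[/(_ x erefl)].
Qed.

Lemma discrete_measurable (A : set (borel X)) : measurable A.
Proof. by apply: sub_sigma_algebra; exact: X_discrete. Qed.

Lemma convolution_dirac (R : realType) (x : borel X)
    (nu : probability (borel X) R) (A : set (borel X)) :
  convolution (\d_x) nu A = nu [set g : borel X | A ((x : X) + g : X)].
Proof.
rewrite /convolution /pushforward /= /product_measure1 integral_dirac//.
  rewrite diracT mul1e /=; congr (nu _).
  by apply/seteqP; split=> g; rewrite /xsection /= inE.
by move=> _ B _; exact: discrete_measurable.
Qed.

(** The value of [c] is forced by the total mass, [c = 1 / #|G|]; both sides then
    count the points of [G] that [a] translates into [A]. *)
Lemma uniform_on_coset (R : realType) (Q : probability (borel X) R)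
    (G : finite_subgroup X) (a : X) (c : R) (A : set (borel X)) :
    countable [set: borel X] ->
    (forall t : borel X,
       Q [set t] = if (t : X) - a \in elements G then c%:E else 0%E) ->
  Q A = haar G [set g : borel X | A (a + g : X)].
Proof.
move=> X_countable Qt.
pose shift (B : set (borel X)) : set X := [set g | B (a + g)].
have key (B : set (borel X)) : Q B =
    (#|` [fset g in elements G | g \in shift B]%fset|%:R * c)%:E.
  pose F : {fset borel X} := [fset (a + g)%R | g in
    [fset g in elements G | g \in shift B]]%fset.
  have FE t : (t \in F) = ((t : X) - a \in elements G) && (t \in B).
    apply/imfsetP/andP => [[g /=]|[tG tB]].
      rewrite !inE /= => /andP[gG /set_mem /= Bg] ->.
      by rewrite addrAC subrr add0r; split=> //; exact/mem_set.
    exists ((t : X) - a); last by rewrite addrC subrK.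
    rewrite !inE tG /=; apply/mem_set.
    by rewrite /shift /= addrC subrK; exact/set_mem.
  have -> : Q B = Q [set` F].
    have -> : Q B = (Q (B `\` [set` F]) + Q (B `&` [set` F]))%E.
      by apply: measureDI; exact: discrete_measurable.
    have -> : Q (B `\` [set` F]) = 0%E.
      apply: null_of_null_atoms => // [t|t [Bt /negP]].
        exact: discrete_measurable.
      by rewrite FE Qt (mem_set Bt) andbT => /negPf ->.
    rewrite add0e; congr (Q _); apply/seteqP; split=> [t []//|t /= tF].
    by split=> //; move: tF; rewrite FE => /andP[_ /set_mem].
  rewrite probability_fset //; last by move=> t; exact: discrete_measurable.
  rewrite big_seq (eq_bigr (fun=> c%:E)); last first.
    by move=> t; rewrite FE Qt => /andP[-> _].
  rewrite -big_seq sumEFin big_const_seq count_predT iter_addr_0 mulr_natl.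
  by rewrite card_imfset//; exact: addrI.
have Gc : #|` elements G|%:R * c = 1.
  have := key setT; rewrite probability_setT => -[one]; rewrite [RHS]one.
  congr ((#|` _|)%:R * _).
  by apply/fsetP => g; rewrite !inE /= in_setT andbT.
have G_neq0 : #|` elements G|%:R != 0 :> R.
  rewrite pnatr_eq0 -lt0n cardfs_gt0; apply/fset0Pn; exists 0.
  by case: (elements_closed G).
rewrite key (_ : c = #|` elements G|%:R^-1)//.
by apply: (mulfI G_neq0); rewrite Gc divff.
Qed.

End discrete.

Section automorphism.
Variable X : topologicalZmodType.

Lemma automorphism_injB (f : X -> X) : topological_automorphism f ->
  injective f /\ {morph f : x y / x - y}.
Proof.
move=> [fD _ [g [fK gK] _]]; split; first exact: can_inj fK.
by move=> x y; apply/(canRL (addrK _)); rewrite -fD subrK.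
Qed.

End automorphism.

(** * The theorem *)

Theorem theorem3p1 (R : realType) (X : topologicalZmodType)
    (X_discrete : discrete_topological X) (X_countable : @second_countable X)
    (n : nat) (n_ge2 : (2 <= n)%N)
    (d : measure_display) (Omega : measurableType d) (P : probability Omega R)
    (xi : 'I_n -> {RV P >-> borel X})
    (mu : 'I_n -> probability (borel X) R)
    (mu_distr : forall (i : 'I_n) (A : set (borel X)), measurable A ->
       distribution P (xi i) A = mu i A)
    (alpha : 'I_n -> 'I_n -> X -> X)
    (alpha_aut : forall i j : 'I_n, topological_automorphism (alpha i j))
    (xi_indep : mutually_independent P (fun (i : 'I_n) (w : Omega) => xi i w))
    (L_indep : mutually_independent P
       (fun (j : 'I_n) (w : Omega) =>
          (\sum_(i < n) alpha i j (xi i w) : X) : borel X)) :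
  forall i : 'I_n, exists (G : finite_subgroup X) (x : X),
    forall A : set (borel X), measurable A ->
      mu i A = convolution (\d_(x : borel X)) (haar G) A.
Proof.
have cX : countable [set: borel X] by exact: discrete_countable.
have mX := discrete_measurable X_discrete.
pose Y i w : borel X := xi i w.
pose L j w : borel X := (\sum_(i < n) alpha i j (xi i w) : X).
have lawE i A : P (Y i @^-1` A) = mu i A by rewrite -mu_distr.
have mY i : measurable_fun [set: Omega] (Y i) by [].
have mL j : measurable_fun [set: Omega] (L j).
  move=> _ B _; rewrite setTI.
  have -> : L j @^-1` B = [set w | [set t : {ffun 'I_n -> borel X} |
      B (\sum_(i < n) alpha i j (t i) : X)] [ffun i => Y i w]].
    apply/seteqP; split=> w; rewrite /preimage /L /=.
      by under [X in _ -> B X]eq_bigr do rewrite ffunE.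
    by under eq_bigr do rewrite ffunE.
  exact: measurable_joint.
have [p /all_and2[p_gt0 p_mode]] :=
  choice (fun i => exists_mode (mu i) cX (fun=> mX _)).
pose m i := fine (mu i [set p i]).
have mE i : mu i [set p i] = (m i)%:E by rewrite /m fineK// fin_num_measure.
pose mode i := [set x | ((m i)%:E <= mu i [set x])%E].
pose supp i := [set x | (0 < mu i [set x])%E].
have m_gt0 i : 0 < m i by rewrite -lte_fin -mE.
have le_m i t : (mu i [set t] <= (m i)%:E)%E by rewrite -mE.
have modeE i x : mode i x -> mu i [set x] = (m i)%:E.
  by move=> mx; apply/eqP; rewrite eq_le le_m.
have det i j (t : 'I_n -> borel X) (b u : X) :
    alpha i j u = b - \sum_(k < n | k != i) alpha k j (t k) ->
    L j @^-1` [set b] `&` cylinder Y [set~ i] t `<=` Y i @^-1` [set u].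
  move=> ub w [/= Lw wt]; apply: (automorphism_injB (alpha_aut i j)).1.
  rewrite ub -Lw /L (bigD1 i)//= -addrA.
  rewrite [X in _ + X](_ : _ = 0) ?addr0//; apply/eqP; rewrite subr_eq0.
  apply/eqP/eq_bigr => k ki; congr alpha.
  by apply: (wt k); rewrite /= !inE.
have step i k : k != i -> exists2 gam : X -> X, injective gam &
    forall x s, mode i x -> supp k s -> mode i (x + gam s).
  (* One form suffices for each i; the one taken has index j = i. *)
  move=> ki; have [alD _ [g [alK gK] _]] := alpha_aut i i.
  have [ak_inj akB] := automorphism_injB (alpha_aut k i).
  exists (fun s => g (alpha k i (p k - s))).
    by move=> s s' /(can_inj gK) /ak_inj /addrI /oppr_inj.
  move=> x s xmode ssupp.
  (* The point [a] consists of modes, so all forms have a largest atom at its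
     image [b]; [t] moves the coordinate k of [a] to [s], and solving
     [L i = b i] for the coordinate i then gives [x + gam s]. *)
  pose a l : borel X := if l == i then x else p l.
  pose b j : borel X := (\sum_(l < n) alpha l j (a l) : X).
  pose t l : borel X := if l == k then s else p l.
  have a_mode l : mu l [set a l] = (m l)%:E.
    by rewrite /a; case: eqVneq => [->|_]; [exact: modeE|exact: mE].
  have Lb : ((m i)%:E <= P (L i @^-1` [set b i]))%E.
    apply: (@form_atom_ge _ _ _ _ _ P _ Y L a b m) => //.
    - by move=> l; rewrite lawE.
    - by move=> l u; rewrite lawE.
    - move=> w wa j; rewrite /L /b; apply: eq_bigr => l _.
      by have := wa l; rewrite /Y => ->.
    - move=> l j t'; have [_ _ [h [_ hK] _]] := alpha_aut l j.
      exists (h (b j - \sum_(k < n | k != l) alpha k j (t' k))).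
      by apply: det; rewrite hK.
  rewrite /mode /= -lawE.
  apply: (@determined_value_mode _ _ _ _ _ P _ Y cX _ mY xi_indep i
    (L i @^-1` [set b i]) (m i) _ _ _ t) => //.
  - by rewrite -[X in measurable X]setTI; exact: mL.
  - by move=> u; rewrite lawE.
  - move=> t'; exists (g (b i - \sum_(l < n | l != i) alpha l i (t' l))).
    by apply: det; rewrite gK.
  - apply: cylinder_gt0 => // l _; rewrite lawE /t.
    by case: eqVneq => [->|_]; [exact: ssupp|exact: p_gt0].
  apply: det; rewrite alD gK akB /b /t.
  rewrite (bigD1 i)//= [in RHS](bigD1 k)//= [\sum_(_ < n | _ != i) _](bigD1 k)//=.
  rewrite /a eqxx (negPf ki) eqxx opprD -addrA; congr (_ + _).
  rewrite [in RHS]addrACA [X in _ = _ + X](_ : _ = 0) ?addr0//.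
  apply/eqP; rewrite subr_eq0; apply/eqP/eq_bigr => l /andP[li lk].
  by rewrite (negPf li) (negPf lk).
move=> i; have [k ki] : exists k, k != i.
  have [i0|i0] := eqVneq (val i) 0%N.
    by exists (Ordinal n_ge2); rewrite -val_eqE /= i0.
  by exists (Ordinal (ltnW n_ge2)); rewrite -val_eqE /= eq_sym.
have [gam gam_inj gamP] := step i k ki.
have [|gam' gam'_inj gam'P] := step k i; first by rewrite eq_sym.
have mode_supp l : mode l `<=` supp l.
  by move=> x; apply: lt_le_trans; rewrite lte_fin.
have mode_fin l : finite_set (mode l) by exact: finite_large_atoms.
have mode_p l : mode l (p l) by rewrite /mode /= mE.
have [modeS [G GE]] := coset_of_mutual_translates gam_inj gam'_inj
  (mode_supp i) (mode_supp k) (mode_fin i) (mode_fin k) (mode_p i) (mode_p k)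
  gamP gam'P.
exists G, (p i) => A _; rewrite convolution_dirac//.
apply: (@uniform_on_coset _ X_discrete _ _ _ _ (m i)) => // t.
have suppE : (t : X) - p i \in elements G <-> supp i t by rewrite GE.
case: ifPn => [/suppE|/negP tG]; first by rewrite -modeS => /modeE.
apply/eqP; rewrite eq_le measure_ge0 andbT leNgt; apply/negP => /suppE.
exact: tG.
Qed.
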